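(* Let $(\mathcal{C},\otimes,I)$ be a monoidal category with finite products and finite coproducts, and suppose that for every object $A\in\mathcal{C}$, the functor $A\otimes -:\mathcal{C}\to\mathcal{C}$ preserves products and the functor $-\otimes A:\mathcal{C}\to\mathcal{C}$ preserves coproducts. Then $\mathcal{C}$ has finite biproducts.
   Context: Finite products include the nullary product (a terminal object $1$), and finite coproducts include the nullary coproduct (an initial object $0$). A functor is said to preserve products if the image of a (finite) product cone is always a product cone (not necessarily the chosen one), including the nullary case: the image of a terminal object is terminal. Preservation of coproducts is defined dually, including that the image of an initial object is initial. For a morphism $f: A+B\to C\times D$ in a category with finite products and coproducts, with product projections $\pi_1,\pi_2$ and coproduct injections $i_1,i_2$, write $f=\begin{bmatrix} f_{11} & f_{12}\\ f_{21} & f_{22}\end{bmatrix}$, where $f_{jk}=\pi_j\circ f\circ i_k$; $f$ is uniquely determined by these four maps, and any four maps $f_{11}:A\to C$, $f_{12}:B\to C$, $f_{21}:A\to D$, $f_{22}:B\to D$ arise in this way. A category $\mathcal{C}$ has finite biproducts if it has finite products and finite coproducts, such that: (i) the unique morphism $0\to 1$ is invertible, so that there is a zero map $0_{A,B}: A\to 1\cong 0\to B$ between any objects $A$ and $B$; and (ii) the morphism $\begin{bmatrix} 1_A & 0_{B,A}\\ 0_{A,B} & 1_B\end{bmatrix}: A+B\to A\times B$ is invertible for all objects $A$ and $B$ of $\mathcal{C}$. *)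

(* Defs.v *)
From mathcomp Require Import all_boot.

Set Implicit Arguments.
Unset Strict Implicit.
Unset Printing Implicit Defensive.

Declare Scope cat_scope.
Delimit Scope cat_scope with cat.
Local Open Scope cat_scope.

Record category : Type := Category {
  ob :> Type;
  hom : ob -> ob -> Type;
  idm : forall A, hom A A;
  compose : forall A B C, hom B C -> hom A B -> hom A C;
  compose_idl : forall A B (f : hom A B), compose (idm B) f = f;
  compose_idr : forall A B (f : hom A B), compose f (idm A) = f;
  composeA : forall A B C D (h : hom C D) (g : hom B C) (f : hom A B),
    compose h (compose g f) = compose (compose h g) f
}.
Arguments idm {c} A.

Notation "g ∘ f" := (compose g f)
  (at level 40, left associativity) : cat_scope.

Definition are_inverse (C : category) (A B : C) (f : hom A B) (g : hom B A) :
    Prop :=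
  g ∘ f = idm A /\ f ∘ g = idm B.

Definition is_iso (C : category) (A B : C) (f : hom A B) : Prop :=
  exists g : hom B A, are_inverse f g.

Record functor (C D : category) : Type := Functor {
  fob :> C -> D;
  fmap : forall A B : C, hom A B -> hom (fob A) (fob B);
  fmap_id : forall A : C, fmap (idm A) = idm (fob A);
  fmap_comp : forall (A B E : C) (g : hom B E) (f : hom A B),
    fmap (g ∘ f) = fmap g ∘ fmap f
}.
Arguments fmap {C D} F {A B} f : rename.

Section ProductCategory.
Variables C D : category.

Definition prodcat_hom (A B : C * D) : Type := (hom A.1 B.1 * hom A.2 B.2)%type.

Definition prodcat_id (A : C * D) : prodcat_hom A A := (idm A.1, idm A.2).

Definition prodcat_comp (A B E : C * D) (g : prodcat_hom B E)
    (f : prodcat_hom A B) : prodcat_hom A E :=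
  (g.1 ∘ f.1, g.2 ∘ f.2).

Lemma prodcat_idl A B (f : prodcat_hom A B) :
  prodcat_comp (prodcat_id B) f = f.
Proof. by case: f => f1 f2; rewrite /prodcat_comp /= !compose_idl. Qed.

Lemma prodcat_idr A B (f : prodcat_hom A B) :
  prodcat_comp f (prodcat_id A) = f.
Proof. by case: f => f1 f2; rewrite /prodcat_comp /= !compose_idr. Qed.

Lemma prodcat_assoc A B E F (h : prodcat_hom E F) (g : prodcat_hom B E)
    (f : prodcat_hom A B) :
  prodcat_comp h (prodcat_comp g f) = prodcat_comp (prodcat_comp h g) f.
Proof. by rewrite /prodcat_comp /= !composeA. Qed.

Definition prodcat : category :=
  Category prodcat_idl prodcat_idr prodcat_assoc.
End ProductCategory.

(* The action of a bifunctor on a pair of morphisms; the type ascription lets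
   the pair be read as a morphism of the product category. *)
Definition bimap (C D E : category) (T : functor (prodcat C D) E)
    (A A' : C) (B B' : D) (f : hom A A') (g : hom B B') :
    hom (T (A, B)) (T (A', B')) :=
  fmap T (A := (A, B)) (B := (A', B')) (f, g).

Record monoidal (C : category) : Type := Monoidal {
  tensor : functor (prodcat C C) C;
  unit_ob : C;
  assoc : forall A B D : C,
    hom (tensor (tensor (A, B), D)) (tensor (A, tensor (B, D)));
  lunit : forall A : C, hom (tensor (unit_ob, A)) A;
  runit : forall A : C, hom (tensor (A, unit_ob)) A;
  assoc_iso : forall A B D : C, is_iso (assoc A B D);
  lunit_iso : forall A : C, is_iso (lunit A);
  runit_iso : forall A : C, is_iso (runit A);
  assoc_natural : forall (A A' B B' D D' : C)
      (f : hom A A') (g : hom B B') (h : hom D D'),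
    assoc A' B' D' ∘ bimap tensor (bimap tensor f g) h
      = bimap tensor f (bimap tensor g h) ∘ assoc A B D;
  lunit_natural : forall (A A' : C) (f : hom A A'),
    lunit A' ∘ bimap tensor (idm unit_ob) f = f ∘ lunit A;
  runit_natural : forall (A A' : C) (f : hom A A'),
    runit A' ∘ bimap tensor f (idm unit_ob) = f ∘ runit A;
  pentagon : forall A B D E : C,
    assoc A B (tensor (D, E)) ∘ assoc (tensor (A, B)) D E
      = bimap tensor (idm A) (assoc B D E) ∘ assoc A (tensor (B, D)) E
          ∘ bimap tensor (assoc A B D) (idm E);
  triangle : forall A B : C,
    bimap tensor (idm A) (lunit B) ∘ assoc A unit_ob B
      = bimap tensor (runit A) (idm B)
}.

Section TensorFunctors.
Variables (C : category) (M : monoidal C) (A : C).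

Lemma tensor_left_id (B : C) :
  bimap (tensor M) (idm A) (idm B) = idm (tensor M (A, B)).
Proof. exact: (fmap_id (tensor M) (A, B)). Qed.

Lemma tensor_left_comp (B D E : C) (g : hom D E) (f : hom B D) :
  bimap (tensor M) (idm A) (g ∘ f)
    = bimap (tensor M) (idm A) g ∘ bimap (tensor M) (idm A) f.
Proof. by rewrite /bimap -fmap_comp /= /prodcat_comp /= compose_idl. Qed.

(* A ⊗ - *)
Definition tensor_left : functor C C :=
  Functor tensor_left_id tensor_left_comp.

Lemma tensor_right_id (B : C) :
  bimap (tensor M) (idm B) (idm A) = idm (tensor M (B, A)).
Proof. exact: (fmap_id (tensor M) (B, A)). Qed.

Lemma tensor_right_comp (B D E : C) (g : hom D E) (f : hom B D) :
  bimap (tensor M) (g ∘ f) (idm A)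
    = bimap (tensor M) g (idm A) ∘ bimap (tensor M) f (idm A).
Proof. by rewrite /bimap -fmap_comp /= /prodcat_comp /= compose_idl. Qed.

(* - ⊗ A *)
Definition tensor_right : functor C C :=
  Functor tensor_right_id tensor_right_comp.
End TensorFunctors.

Definition is_product (C : category) (J : Type) (X : J -> C) (P : C)
    (p : forall j, hom P (X j)) : Prop :=
  forall (T : C) (f : forall j, hom T (X j)),
    exists! h : hom T P, forall j, p j ∘ h = f j.

Definition is_coproduct (C : category) (J : Type) (X : J -> C) (S : C)
    (i : forall j, hom (X j) S) : Prop :=
  forall (T : C) (f : forall j, hom (X j) T),
    exists! h : hom S T, forall j, h ∘ i j = f j.

(* Chosen finite products, indexed by arbitrary finite types (in particular by
   [void]). The induced map [tuple] is kept as data next to the universal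
   property so that morphisms can be built from it without a choice axiom. *)
Record finite_products (C : category) : Type := FiniteProducts {
  prod_ob : forall J : finType, (J -> C) -> C;
  proj : forall (J : finType) (X : J -> C) (j : J), hom (prod_ob X) (X j);
  proj_is_product : forall (J : finType) (X : J -> C), is_product (@proj J X);
  tuple_map : forall (J : finType) (X : J -> C) (T : C),
    (forall j, hom T (X j)) -> hom T (prod_ob X);
  proj_tuple : forall (J : finType) (X : J -> C) (T : C)
      (f : forall j, hom T (X j)) (j : J),
    proj X j ∘ tuple_map f = f j
}.

Record finite_coproducts (C : category) : Type := FiniteCoproducts {
  coprod_ob : forall J : finType, (J -> C) -> C;
  inj : forall (J : finType) (X : J -> C) (j : J), hom (X j) (coprod_ob X);
  inj_is_coproduct : forall (J : finType) (X : J -> C),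
    is_coproduct (@inj J X);
  cotuple_map : forall (J : finType) (X : J -> C) (T : C),
    (forall j, hom (X j) T) -> hom (coprod_ob X) T;
  cotuple_inj : forall (J : finType) (X : J -> C) (T : C)
      (f : forall j, hom (X j) T) (j : J),
    cotuple_map f ∘ inj X j = f j
}.

Definition preserves_products (C D : category) (F : functor C D) : Prop :=
  forall (J : finType) (X : J -> C) (P : C) (p : forall j, hom P (X j)),
    is_product p -> is_product (fun j => fmap F (p j)).

Definition preserves_coproducts (C D : category) (F : functor C D) : Prop :=
  forall (J : finType) (X : J -> C) (S : C) (i : forall j, hom (X j) S),
    is_coproduct i -> is_coproduct (fun j => fmap F (i j)).

(* Binary (co)products are indexed by [bool], with [true] the first index. *)
Definition pair_family (C : category) (A B : C) (b : bool) : C :=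
  if b then A else B.

Section Biproducts.
Variables (C : category) (P : finite_products C) (Q : finite_coproducts C).

Definition terminal_ob : C := prod_ob P (of_void C).

Definition to_terminal (A : C) : hom A terminal_ob :=
  tuple_map P (X := of_void C) (fun j : void => match j with end).

Definition initial_ob : C := coprod_ob Q (of_void C).

Definition from_initial (A : C) : hom initial_ob A :=
  cotuple_map Q (X := of_void C) (fun j : void => match j with end).

Definition bin_prod (A B : C) : C := prod_ob P (pair_family A B).

Definition pairing (T A B : C) (f : hom T A) (g : hom T B) :
    hom T (bin_prod A B) :=
  tuple_map P (X := pair_family A B)
    (fun b => if b return hom T (pair_family A B b) then f else g).

Definition bin_coprod (A B : C) : C := coprod_ob Q (pair_family A B).

Definition copairing (A B T : C) (f : hom A T) (g : hom B T) :
    hom (bin_coprod A B) T :=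
  cotuple_map Q (X := pair_family A B)
    (fun b => if b return hom (pair_family A B b) T then f else g).

(* The morphism A + B -> D × E whose component π_j ∘ f ∘ i_k is f_jk. *)
Definition matrix_map (A B D E : C) (f11 : hom A D) (f12 : hom B D)
    (f21 : hom A E) (f22 : hom B E) : hom (bin_coprod A B) (bin_prod D E) :=
  pairing (copairing f11 f12) (copairing f21 f22).

Definition initial_to_terminal : hom initial_ob terminal_ob :=
  to_terminal initial_ob.

Definition zero_map (z : hom terminal_ob initial_ob) (A B : C) : hom A B :=
  from_initial B ∘ z ∘ to_terminal A.

(* The witness [z] is the inverse of 0 -> 1, hence unique. *)
Definition has_finite_biproducts : Prop :=
  exists2 z : hom terminal_ob initial_ob,
    are_inverse initial_to_terminal z &
    forall A B : C,
      is_iso (matrix_map (idm A) (zero_map z B A) (zero_map z A B) (idm B)).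
End Biproducts.

(* Main.v *)
Require Import Defs.
From mathcomp Require Import all_boot.

(** Zero object: since [0 ⊗ -] preserves the terminal object and [- ⊗ 1]
    preserves the initial one, [0 ⊗ 1] is both terminal and initial.  This
    gives a map [1 -> 0], which is automatically inverse to [0 -> 1].

    Biproducts: the object [W = (A + B) ⊗ (I × I)] decomposes in two ways.
    As a value of [(A + B) ⊗ -] it is the product [(A + B) × (A + B)]; as a
    value of [- ⊗ (I × I)] it is the coproduct of [A ⊗ (I × I)] and
    [B ⊗ (I × I)], that is, [(A × A) + (B × B)].  Bifunctoriality of the
    tensor makes the two decompositions compatible: the resulting isomorphism
    [(A × A) + (B × B) -> (A + B) × (A + B)] is the canonical map [i × i] on
    each summand.

    The zero maps exhibit [A + B] as a retract of [(A × A) + (B × B)] (enter by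
    [<1, 0>] and [<0, 1>], leave by the two diagonal projections) and [A × B]
    as a retract of [(A + B) × (A + B)] (enter by [i_1 × i_2], leave by
    [[1, 0] × [0, 1]]).  Both retractions commute with the canonical maps, so
    the identity matrix [A + B -> A × B] is a retract of an isomorphism, hence
    an isomorphism; its inverse is [A × B -> W -> A + B].  This retract
    argument is [iso_of_double_decomposition]; the decompositions of [W] are
    assembled in [matrix_map_iso]. *)

Set Implicit Arguments.
Unset Strict Implicit.
Unset Printing Implicit Defensive.

Local Open Scope cat_scope.

Section UniversalProperties.
Variables (C : category) (J : Type) (X : J -> C).

Lemma product_hom_ext (P : C) (p : forall j, hom P (X j)) (T : C)
    (f g : hom T P) :
  is_product p -> (forall j, p j ∘ f = p j ∘ g) -> f = g.
Proof.
move=> Hp fg; have [h [_ uniq_h]] := Hp T (fun j => p j ∘ g).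
by rewrite -(uniq_h f fg) -(uniq_h g).
Qed.

Lemma coproduct_hom_ext (S : C) (i : forall j, hom (X j) S) (T : C)
    (f g : hom S T) :
  is_coproduct i -> (forall j, f ∘ i j = g ∘ i j) -> f = g.
Proof.
move=> Hi fg; have [h [_ uniq_h]] := Hi T (fun j => g ∘ i j).
by rewrite -(uniq_h f fg) -(uniq_h g).
Qed.

Lemma is_product_iso (Y : J -> C) (P : C) (p : forall j, hom P (X j))
    (e : forall j, hom (X j) (Y j)) (e' : forall j, hom (Y j) (X j)) :
  (forall j, are_inverse (e j) (e' j)) -> is_product p ->
  is_product (fun j => e j ∘ p j).
Proof.
move=> ee' Hp T f; have [h [ph _]] := Hp T (fun j => e' j ∘ f j).
exists h; split=> [j|h' ph'].
  by rewrite -composeA ph composeA (ee' j).2 compose_idl.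
apply: (product_hom_ext Hp) => j.
by rewrite ph -ph' !composeA (ee' j).1 compose_idl.
Qed.
End UniversalProperties.

Section ZeroMaps.
Variables (C : category) (P : finite_products C) (Q : finite_coproducts C).

Lemma to_terminal_unique (A : C) (f g : hom A (terminal_ob P)) : f = g.
Proof. by apply: (product_hom_ext (proj_is_product P (X := of_void C))). Qed.

Lemma from_initial_unique (A : C) (f g : hom (initial_ob Q) A) : f = g.
Proof. by apply: (coproduct_hom_ext (inj_is_coproduct Q (X := of_void C))). Qed.

Lemma terminal_to_initial_inverse (z : hom (terminal_ob P) (initial_ob Q)) :
  are_inverse (initial_to_terminal P Q) z.
Proof. by split; [apply: from_initial_unique | apply: to_terminal_unique]. Qed.

Variable z : hom (terminal_ob P) (initial_ob Q).

Lemma compose_zero (A B D : C) (f : hom B D) :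
  f ∘ zero_map z A B = zero_map z A D.
Proof.
by rewrite /zero_map !composeA; congr (_ ∘ _ ∘ _); apply: from_initial_unique.
Qed.

Lemma zero_compose (A B D : C) (f : hom A B) :
  zero_map z B D ∘ f = zero_map z A D.
Proof.
by rewrite /zero_map -!composeA; do 2 congr (_ ∘ _); apply: to_terminal_unique.
Qed.

(** A retract of an isomorphism is an isomorphism: [S] is a retract of the
    coproduct of the powers [X k] of the [A k], [T] is a retract of the power of
    [S], and [W] carries both structures.  The equations relating [p] and [c]
    say that the comparison between the two is the canonical one, which makes
    [m] compatible with the retractions.  The inverse of [m] enters [W] through
    the power of [S] and leaves it through the coproduct of the [X k]. *)
Lemma iso_of_double_decomposition (J : eqType) (A : J -> C)
    (S : C) (i : forall k, hom (A k) S)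
    (T : C) (pi : forall j, hom T (A j))
    (m : hom S T)
    (W : C) (p : J -> hom W S)
    (X : J -> C) (c : forall k, hom (X k) W)
    (q : forall k : J, J -> hom (X k) (A k)) :
  is_coproduct i -> is_product pi ->
  (forall k, pi k ∘ m ∘ i k = idm (A k)) ->
  (forall j k, j != k -> pi j ∘ m ∘ i k = zero_map z (A k) (A j)) ->
  is_product p -> is_coproduct c -> (forall k, is_product (q k)) ->
  (forall j k, p j ∘ c k = i k ∘ q k j) ->
  is_iso m.
Proof.
move=> Hi Hpi m_diag m_off Hp Hc Hq p_c.
(* [u] is the product of the injections, [r] the sum of the diagonal
   projections. *)
have [u [p_u _]] := Hp T (fun j => i j ∘ pi j).
have [r [r_c _]] := Hc S (fun k => i k ∘ q k k).
exists (r ∘ u); split.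
  apply: (coproduct_hom_ext Hi) => k; rewrite compose_idl.
  (* [e] inserts [A k] in its power [X k] at position [k]. *)
  have [e [q_e _]] := Hq k (A k)
    (fun j => if j == k then idm (A k) else zero_map z (A k) (A k)).
  have u_m : u ∘ m ∘ i k = c k ∘ e.
    apply: (product_hom_ext Hp) => j.
    rewrite !composeA p_u p_c -!composeA q_e (composeA (pi j)).
    case: eqVneq => [->|jk]; first by rewrite m_diag.
    by rewrite m_off // !compose_zero.
  by rewrite -!composeA (composeA u) u_m composeA r_c -composeA q_e eqxx
             compose_idr.
(* After [pi j ∘ m] only the [j]-th summand survives, where the diagonal
   projection agrees with the [j]-th one. *)
have m_r j : pi j ∘ m ∘ r = pi j ∘ m ∘ p j.
  apply: (coproduct_hom_ext Hc) => k.
  rewrite -!(composeA _ _ (c k)) r_c p_c !(composeA _ (i k)).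
  by have [->|jk] := eqVneq j k; rewrite // m_off // !zero_compose.
apply: (product_hom_ext Hpi) => j.
by rewrite !composeA m_r -composeA p_u composeA m_diag compose_idl compose_idr.
Qed.

Lemma matrix_map_entry (A B D E : C) (f11 : hom A D) (f12 : hom B D)
    (f21 : hom A E) (f22 : hom B E) (j k : bool) :
  proj P (pair_family D E) j ∘ matrix_map P Q f11 f12 f21 f22
    ∘ inj Q (pair_family A B) k
  = match j, k return hom (pair_family A B k) (pair_family D E j) with
    | true, true => f11
    | true, false => f12
    | false, true => f21
    | false, false => f22
    end.
Proof.
by rewrite /matrix_map /pairing proj_tuple; case: j k => [] [];
  rewrite /copairing cotuple_inj.
Qed.
End ZeroMaps.

Section Biproducts.
Variables (C : category) (M : monoidal C).
Variables (P : finite_products C) (Q : finite_coproducts C).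
Hypothesis tensor_prod : forall A : C, preserves_products (tensor_left M A).
Hypothesis tensor_coprod :
  forall A : C, preserves_coproducts (tensor_right M A).

Lemma bimap_interchange (A A' B B' : C) (f : hom A A') (g : hom B B') :
  bimap (tensor M) (idm A') g ∘ bimap (tensor M) f (idm B)
  = bimap (tensor M) f (idm B') ∘ bimap (tensor M) (idm A) g.
Proof.
by rewrite /bimap -!fmap_comp /= /prodcat_comp /= !(compose_idl, compose_idr).
Qed.

(** The map factors through [0 ⊗ 1], which is terminal and initial. *)
Lemma exists_terminal_to_initial :
  inhabited (hom (terminal_ob P) (initial_ob Q)).
Proof.
have Ht := tensor_prod (A := initial_ob Q)
  (proj_is_product P (X := of_void C)).
have Hi := tensor_coprod (A := terminal_ob P)
  (inj_is_coproduct Q (X := of_void C)).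
have [a _] := Ht (terminal_ob P) (fun j : void => match j with end).
have [b _] := Hi (initial_ob Q) (fun j : void => match j with end).
exact (inhabits (b ∘ a)).
Qed.

(** Here [J -> I] is a power of the unit, so tensoring with an object [A]
    gives a power of [A]. *)
Lemma tensor_unit_power (J : finType) (A : C) :
  is_product (fun j : J => runit M A
    ∘ bimap (tensor M) (idm A) (proj P (fun=> unit_ob M) j)).
Proof.
have [r' r_r'] := runit_iso M A.
apply: (is_product_iso (e' := fun=> r')) => // T f.
exact: (tensor_prod (A := A) (proj_is_product P (X := fun=> unit_ob M))).
Qed.

Lemma matrix_map_iso (z : hom (terminal_ob P) (initial_ob Q)) (A B : C) :
  is_iso
    (matrix_map P Q (idm A) (zero_map z B A) (zero_map z A B) (idm B)).
Proof.
pose II := prod_ob P (fun _ : bool => unit_ob M).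
have q_prod k := tensor_unit_power (J := bool) (A := pair_family A B k).
pose c k := bimap (tensor M) (inj Q (pair_family A B) k) (idm II).
apply: (iso_of_double_decomposition (z := z) (c := c)
  (inj_is_coproduct Q (X := pair_family A B))
  (proj_is_product P (X := pair_family A B))
  _ _ (tensor_unit_power (J := bool) (A := bin_coprod Q A B)) _ q_prod).
- by move=> k; rewrite matrix_map_entry; case: k.
- by move=> j k; rewrite matrix_map_entry; case: j k => [] [].
- exact: (tensor_coprod (A := II) (inj_is_coproduct Q (X := pair_family A B))).
- move=> j k; rewrite -composeA bimap_interchange !composeA.
  by rewrite runit_natural.
Qed.
End Biproducts.

Theorem proposition2 (C : category) (M : monoidal C)
    (P : finite_products C) (Q : finite_coproducts C)
    (tensor_prod : forall A : C, preserves_products (tensor_left M A))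
    (tensor_coprod : forall A : C, preserves_coproducts (tensor_right M A)) :
  has_finite_biproducts P Q.
Proof.
have [z] := exists_terminal_to_initial P Q tensor_prod tensor_coprod.
exists z; first exact: terminal_to_initial_inverse.
exact: matrix_map_iso tensor_prod tensor_coprod z.
Qed.
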